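(* There exists a reduced torsion-free atomic monoid $M$ of rank $\aleph_0$ such that for every integral domain $R$, the monoid domain $R[x;M]$ is not atomic.
   Context: All monoids are commutative and cancellative, written additively. $M$ is reduced if its only invertible element is $0$; torsion-free if $nx = ny$ for some $n \in \mathbb{N}$ implies $x = y$. An atom of $M$ is a non-invertible element $a$ such that $a = x+y$ implies $x$ or $y$ is invertible; $M$ is atomic if every non-invertible element is a finite sum of atoms. The rank of $M$ is the rank of its Grothendieck group $\mathsf{gp}(M)$, i.e. $\dim_{\mathbb{Q}} \mathbb{Q} \otimes_{\mathbb{Z}} \mathsf{gp}(M)$. For an integral domain $R$, $R[x;M]$ is the ring of finitely supported functions $M \to R$ (written $\sum_{s} f(s)x^s$) with the convolution product; it is an integral domain. An integral domain is atomic if every nonzero nonunit is a finite product of irreducible elements. *)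

(* Defs.v *)
From HB Require Import structures.
From mathcomp Require Import all_boot all_order all_algebra.
From mathcomp.multinomials Require Export monalg.

Set Implicit Arguments.
Unset Strict Implicit.
Unset Printing Implicit Defensive.

Import GRing.Theory.
Local Open Scope ring_scope.

(* Monoids.  The paper writes its commutative monoids additively; the   *)
(* library monoid algebra {malg R[M]} (= R[x;M]) uses a commutative     *)
(* monoid [M : conomType] written multiplicatively with operation       *)
(* [mmul] and neutral element [mone].  x^s in R[x;M] is << s >>.        *)

Section MonoidDefs.
Variable M : conomType.

Definition munit (x : M) : Prop := exists y : M, mmul x y = mone.

Definition mcancellative : Prop :=
  forall x y z : M, mmul x y = mmul x z -> y = z.

Definition mreduced : Prop := forall x : M, munit x -> x = mone.

Fixpoint mpow (x : M) (n : nat) : M :=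
  if n is n'.+1 then mmul x (mpow x n') else mone.

Definition mtorsion_free : Prop :=
  forall (n : nat) (x y : M), (0 < n)%N -> mpow x n = mpow y n -> x = y.

Definition matom (a : M) : Prop :=
  ~ munit a /\ forall x y : M, a = mmul x y -> munit x \/ munit y.

Definition matomic : Prop :=
  forall x : M, ~ munit x ->
    exists s : seq M, (forall a, a \in s -> matom a) /\ x = foldr mmul mone s.

(* (G, iota) is a Grothendieck group of M: iota is an injective monoid
   morphism into the abelian group G with G = iota M - iota M.  For a
   cancellative M this determines G up to isomorphism as gp(M). *)
Definition grothendieck_group (G : zmodType) (iota : M -> G) : Prop :=
  [/\ iota mone = 0,
      forall x y, iota (mmul x y) = iota x + iota y,
      injective iota &
      forall g : G, exists a b : M, g = iota a - iota b].
End MonoidDefs.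

(* rank of an abelian group G, i.e. dim_Q (Q (x)_Z G), equal to aleph_0:
   Q (x)_Z G has a countably infinite basis.  Bases of Q (x)_Z G
   correspond exactly to maximal Z-linearly independent families of G,
   so this says: there is a Z-independent sequence e : nat -> G such that
   every g in G has a nonzero integer multiple in the Z-span of e. *)
Definition zindependent (G : zmodType) (e : nat -> G) : Prop :=
  forall (n : nat) (c : nat -> int),
    \sum_(i < n) e i *~ c i = 0 -> forall i, (i < n)%N -> c i = 0.

Definition rank_aleph0 (G : zmodType) : Prop :=
  exists e : nat -> G,
    zindependent e /\
    forall g : G, exists (k : int) (n : nat) (c : nat -> int),
      k != 0 /\ g *~ k = \sum_(i < n) e i *~ c i.

Definition mrank_aleph0 (M : conomType) : Prop :=
  exists (G : zmodType) (iota : M -> G),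
    grothendieck_group iota /\ rank_aleph0 G.

Section RingDefs.
Variable A : comRingType.

Definition runit (x : A) : Prop := exists y : A, x * y = 1.

Definition rirreducible (x : A) : Prop :=
  [/\ x != 0, ~ runit x &
      forall y z : A, x = y * z -> runit y \/ runit z].

Definition ratomic : Prop :=
  forall x : A, x != 0 -> ~ runit x ->
    exists s : seq A, (forall a, a \in s -> rirreducible a) /\
                      x = \prod_(a <- s) a.
End RingDefs.

(* Main.v *)
Require Import Defs.
From HB Require Import structures.
From Stdlib Require Import ClassicalEpsilon.
From mathcomp Require Import all_boot all_order all_algebra.
From mathcomp Require Import finmap zify ring.
From mathcomp.multinomials Require Import monalg.

(* Let G be the free abelian group on t_0, t_1, p_{0,n}, p_{1,n}, d_n (n >= 0)
   and let M be the submonoid generated by the d_n, the p_{j,n} and the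
     q_{j,n} = t_j - (d_0 + ... + d_n) - p_{j,n}.
   These generators are atoms of M.  The only factorizations of t_j are
     t_j = d_0 + ... + d_n + p_{j,n} + q_{j,n},
   so a common divisor of t_0 and t_1 is a sum of distinct d_i, and it can
   always be enlarged by a further d_i: t_0 and t_1 have no maximal common
   divisor.  On the other hand t_1 - t_0 is part of a basis of G, so in any
   factorization of x^{t_0} + x^{t_1} in R[x;M] all factors but one are
   monomials; the remaining one is, up to a unit, x^{t_0 - d} + x^{t_1 - d} for
   a common divisor d, which is divisible by a nontrivial monomial. *)

Set Implicit Arguments.
Unset Strict Implicit.
Unset Printing Implicit Defensive.

Import Order.TTheory GRing.Theory Num.Theory.
Local Open Scope ring_scope.

(** * Binomials in a monoid algebra *)

Lemma seq_argmax (T : eqType) (phi : T -> int) (s : seq T) :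
  s != [::] -> exists2 x, x \in s & {in s, forall y, phi y <= phi x}.
Proof.
elim: s => // a s IHs _; case: (s =P [::]) => [-> | /eqP/IHs[x xs xmax]].
  by exists a; rewrite ?mem_head // => y /[1!inE] /eqP->.
case: (leP (phi a) (phi x)) => [le_ax | lt_xa].
  exists x => [|y]; rewrite inE ?xs ?orbT //.
  by case/predU1P => [-> | /xmax].
exists a => [|y]; rewrite inE ?eqxx // => /predU1P[-> // | /xmax le_yx].
exact: le_trans le_yx (ltW lt_xa).
Qed.

Section MonoidAlgebra.
Variables (M : conomType) (R : idomainType).
Implicit Types (x y z m d : M) (c a b : R) (g h f : {malg R[M]}) (s : seq M).

(** If [mmul x y = mmul x0 y0] with [x], [y] in the supports, maximality forces [phi x = phi x0] and
    [phi y = phi y0]; injectivity then leaves a single term in the convolution. *)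
Lemma mcoeffM_argmax (phi : M -> int) g h x0 y0 :
    {morph phi : x y / mmul x y >-> x + y} ->
    {in msupp g &, injective phi} -> {in msupp h &, injective phi} ->
    x0 \in msupp g -> {in msupp g, forall x, phi x <= phi x0} ->
    y0 \in msupp h -> {in msupp h, forall y, phi y <= phi y0} ->
  (g * h)@_(mmul x0 y0) = g@_x0 * h@_y0.
Proof.
move=> phiM injg injh x0g x0max y0h y0max; rewrite mcoeffMl.
have key x y : x \in msupp g -> y \in msupp h ->
    (mmul x y == mmul x0 y0) = (x == x0) && (y == y0).
  move=> xg yh; apply/eqP/andP => [/(congr1 phi) | [/eqP-> /eqP->] //].
  rewrite !phiM => eq_phi.
  have := x0max _ xg; have := y0max _ yh => le_y le_x.
  by split; apply/eqP; [apply: injg | apply: injh] => //; lia.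
rewrite (big_rem x0) //= [X in _ + X]big_seq [X in _ + X]big1 => [|x];
  last first.
  rewrite mem_rem_uniq ?fset_uniq // => /andP[/= ne_x xg].
  rewrite big_seq big1 // => y yh.
  by rewrite key // (negbTE ne_x).
rewrite addr0 (big_rem y0) //= eqxx mulr1n big_seq big1 ?addr0 // => y.
rewrite mem_rem_uniq ?fset_uniq // => /andP[/= ne_y yh].
by rewrite key // (negbTE ne_y) andbF.
Qed.

Lemma msuppM_argmax (phi : M -> int) g h :
    {morph phi : x y / mmul x y >-> x + y} ->
    {in msupp g &, injective phi} -> {in msupp h &, injective phi} ->
    g != 0 -> h != 0 ->
  exists x0 y0, [/\ x0 \in msupp g, {in msupp g, forall x, phi x <= phi x0},
    y0 \in msupp h, {in msupp h, forall y, phi y <= phi y0} &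
    mmul x0 y0 \in msupp (g * h)].
Proof.
move=> phiM injg injh nz_g nz_h.
have supp_nnil f : f != 0 -> (msupp f : seq M) != [::].
  by apply: contraNneq => f0; rewrite (monalgE f) f0 big_nil.
have [x0 x0g x0max] := seq_argmax phi (supp_nnil _ nz_g).
have [y0 y0h y0max] := seq_argmax phi (supp_nnil _ nz_h).
exists x0, y0; split=> //.
rewrite -mcoeff_neq0 (mcoeffM_argmax phiM) // mulf_neq0 //.
  by rewrite mcoeff_neq0.
by rewrite mcoeff_neq0.
Qed.

(** A substitute for [y - x] being part of a basis of gp(M). The functional may depend on the finite
    set [s]: a group of infinite rank has no injective morphism to the integers, but only the
    supports of two factors must be separated. *)
Definition primitive_pair x y := forall s, exists phi : M -> int,
  [/\ {morph phi : u v / mmul u v >-> u + v}, {in s &, injective phi} &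
      phi y = phi x + 1].

Lemma primitive_pair_div m x y :
  primitive_pair (mmul m x) (mmul m y) -> primitive_pair x y.
Proof.
move=> pr s; have [phi [phiM inj_phi]] := pr s; rewrite !phiM => eq_phi.
by exists phi; split=> //; lia.
Qed.

Lemma primitive_pair_neq x y : primitive_pair x y -> x != y.
Proof.
move=> /(_ [::])[phi [_ _ eq_phi]].
by apply/eqP => eq_xy; move: eq_phi; rewrite eq_xy; lia.
Qed.

Lemma mcoeff_monomialM (Mcanc : mcancellative M) c m h k :
  (<<c *g m>> * h)@_(mmul m k) = c * h@_k.
Proof.
rewrite malgM_def fgmulUg raddf_sum /= big_seq.
case: (boolP (k \in msupp h)) => [kh | nkh].
  rewrite -big_seq (big_rem k) //= mcoeffU eqxx mulr1n.
  rewrite big_seq big1 ?addr0 // => l.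
  rewrite mem_rem_uniq ?fset_uniq // => /andP[/= ne_l lh].
  by rewrite mcoeffU; case: eqP => // /Mcanc eq_lk; rewrite eq_lk eqxx in ne_l.
rewrite big1 ?mcoeff_outdom ?mulr0 // => l lh.
by rewrite mcoeffU; case: eqP => // /Mcanc eq_lk; rewrite -eq_lk lh in nkh.
Qed.

Lemma msupp_singleton g m :
  {in msupp g, forall x, x = m} -> g = <<g@_m *g m>>.
Proof.
move=> supp_m; apply/malgP => k; rewrite mcoeffU.
case: eqP => [-> | ne_mk] //; apply: mcoeff_outdom.
by apply/negP => /supp_m eq_k; apply: ne_mk.
Qed.

Definition two_terms c x c' y : {malg R[M]} := <<c *g x>> + <<c' *g y>>.

Lemma mcoeff_two_terms c x c' y k :
  (two_terms c x c' y)@_k = c *+ (x == k) + c' *+ (y == k).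
Proof. by rewrite mcoeffD !mcoeffU. Qed.

Lemma two_terms_neq0 c x c' y : c != 0 -> x != y -> two_terms c x c' y != 0.
Proof.
move=> nz_c ne_xy; apply: contraNneq nz_c => /(congr1 (mcoeff x)).
rewrite mcoeff_two_terms mcoeff0 eqxx eq_sym (negbTE ne_xy).
by rewrite addr0 mulr1n => ->.
Qed.

(* A functional [phi] with [phi y - phi x = 1] has total width at most 1 on
   the product, so one of the factors has width 0. *)
Lemma two_terms_factor c x c' y g h :
    primitive_pair x y -> c != 0 -> two_terms c x c' y = g * h ->
  (exists a m, g = <<a *g m>>) \/ (exists a m, h = <<a *g m>>).
Proof.
move=> pr nz_c def_f.
have nz_gh : g * h != 0.
  by rewrite -def_f two_terms_neq0 // primitive_pair_neq.
have nz_g : g != 0 by apply: contraNneq nz_gh => ->; rewrite mul0r.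
have nz_h : h != 0 by apply: contraNneq nz_gh => ->; rewrite mulr0.
have [phi [phiM inj_phi eq_phi]] := pr (msupp g ++ msupp h).
have injg : {in msupp g &, injective phi}.
  by move=> u v ug vg; apply: inj_phi; rewrite mem_cat ?ug ?vg.
have injh : {in msupp h &, injective phi}.
  by move=> u v uh vh; apply: inj_phi; rewrite mem_cat ?uh ?vh orbT.
have [x0 [y0 [x0g x0max y0h y0max]]] := msuppM_argmax phiM injg injh nz_g nz_h.
(* Minima of [phi] are obtained as maxima of [psi]. *)
pose psi u := - phi u.
have psiM : {morph psi : u v / mmul u v >-> u + v}.
  by move=> u v; rewrite /psi phiM opprD.
have psig : {in msupp g &, injective psi}.
  by move=> u v ug vg /oppr_inj; apply: injg.
have psih : {in msupp h &, injective psi}.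
  by move=> u v ug vg /oppr_inj; apply: injh.
have [x1 [y1 [x1g x1max y1h y1max]]] := msuppM_argmax psiM psig psih nz_g nz_h.
have supp_f k : k \in msupp (g * h) -> phi x <= phi k <= phi x + 1.
  rewrite -def_f -mcoeff_neq0 mcoeff_two_terms.
  case: (x =P k) => [-> _ | _]; first by lia.
  by case: (y =P k) => [<- _ | _]; [lia | rewrite addr0 eqxx].
move=> /supp_f; rewrite phiM => le1 /supp_f; rewrite phiM => le0.
have [eq_x | eq_y] : phi x1 = phi x0 \/ phi y1 = phi y0.
- by have := x0max _ x1g; have := y0max _ y1h; lia.
- left; exists g@_x0, x0; apply: msupp_singleton => u ug.
  apply: injg => //; have := x0max _ ug; have := x1max _ ug; rewrite /psi; lia.
- right; exists h@_y0, y0; apply: msupp_singleton => u uh.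
  apply: injh => //; have := y0max _ uh; have := y1max _ uh; rewrite /psi; lia.
Qed.

(** Every exponent of a multiple of [<<a *g m>>] is a multiple of [m]. By cancellation, multiplying
    by this monomial only shifts the exponents of [h] and scales its coefficients by [a]. *)
Lemma two_terms_div_monomial (Mcanc : mcancellative M) c x c' y a m h :
    c != 0 -> c' != 0 -> x != y -> two_terms c x c' y = <<a *g m>> * h ->
  exists b x' b' y', [/\ b != 0, b' != 0, x = mmul m x', y = mmul m y' &
                         h = two_terms b x' b' y'].
Proof.
move=> nz_c nz_c' ne_xy def_f.
have supp_f k : (two_terms c x c' y)@_k != 0 -> exists k', k = mmul m k'.
  rewrite mcoeff_neq0 def_f => /msuppM_le[m' [k' [m'm _ ->]]].
  have /fset1P-> : m' \in [fset m]%fset by apply: (fsubsetP msuppU_le) m'm.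
  by exists k'.
have coef_x : (two_terms c x c' y)@_x = c.
  by rewrite mcoeff_two_terms eqxx eq_sym (negbTE ne_xy) addr0.
have coef_y : (two_terms c x c' y)@_y = c'.
  by rewrite mcoeff_two_terms eqxx (negbTE ne_xy) add0r.
have [x' def_x] : exists x', x = mmul m x' by apply: supp_f; rewrite coef_x.
have [y' def_y] : exists y', y = mmul m y' by apply: supp_f; rewrite coef_y.
have coefs k : (two_terms c x c' y)@_(mmul m k) = a * h@_k.
  by rewrite def_f mcoeff_monomialM.
have def_c : c = a * h@_x' by rewrite -coefs -def_x coef_x.
have def_c' : c' = a * h@_y' by rewrite -coefs -def_y coef_y.
have ne_xy' : x' != y'.
  by apply: contraNneq ne_xy => eq_xy'; rewrite def_x def_y eq_xy'.
have nz_a : a != 0 by apply: contraNneq nz_c => a0; rewrite def_c a0 mul0r.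
exists h@_x', x', h@_y', y'; split=> //.
- by apply: contraNneq nz_c => h0; rewrite def_c h0 mulr0.
- by apply: contraNneq nz_c' => h0; rewrite def_c' h0 mulr0.
apply/malgP => k; rewrite mcoeff_two_terms.
case: eqP => [<- | ne_xk]; first by rewrite eq_sym (negbTE ne_xy') addr0.
case: eqP => [<- | ne_yk]; first by rewrite add0r.
apply/eqP; rewrite addr0; suff: a * h@_k == 0 by rewrite mulf_eq0 (negbTE nz_a).
rewrite -coefs mcoeff_two_terms def_x def_y.
case: (_ =P mmul m k) => [eq_xk | _]; first by case: ne_xk; apply: Mcanc eq_xk.
case: (_ =P mmul m k) => [eq_yk | _]; last by rewrite addr0.
by case: ne_yk; apply: Mcanc eq_yk.
Qed.

(** * Pairs without a maximal common divisor *)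

Definition no_mcd x y := forall d x' y', x = mmul d x' -> y = mmul d y' ->
  exists z x'' y'', [/\ z != mone, x' = mmul z x'' & y' = mmul z y''].

Lemma no_mcd_div m x y : no_mcd (mmul m x) (mmul m y) -> no_mcd x y.
Proof.
move=> nmcd d x' y' def_x def_y.
by apply: (nmcd (mmul m d)); rewrite (def_x, def_y) mulmA.
Qed.

Lemma no_mcd_neq1 x y : no_mcd x y -> x != mone /\ y != mone.
Proof.
move=> /(_ mone x y)[|| z [x' [y' [ne_z -> ->]]]]; rewrite ?mul1m //.
by split; apply: contraNneq ne_z => /unitm[->].
Qed.

(** In a [conomType] only [mone] divides [mone], so the constant coefficient is a ring morphism. *)
Lemma mcoeff1_runit f : runit f -> f@_mone != 0.
Proof.
case=> g /(congr1 (mcoeff mone)); rewrite rmorphM rmorph1 /= => fg1.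
by apply/eqP => f0; move/eqP: fg1; rewrite f0 mul0r eq_sym oner_eq0.
Qed.

Lemma no_mcd_nonunit c x c' y : no_mcd x y -> ~ runit (two_terms c x c' y).
Proof.
case/no_mcd_neq1 => ne_x ne_y /mcoeff1_runit.
by rewrite mcoeff_two_terms (negbTE ne_x) (negbTE ne_y) addr0 eqxx.
Qed.

(* All but one factor of the product would be monomials, and the remaining one
   is a binomial whose two exponents still have a common divisor. *)
Lemma two_terms_not_prod (Mcanc : mcancellative M) (r : seq {malg R[M]})
    c x c' y :
    c != 0 -> c' != 0 -> primitive_pair x y -> no_mcd x y ->
    (forall g, g \in r -> rirreducible g) ->
  two_terms c x c' y <> \prod_(g <- r) g.
Proof.
elim: r c x c' y => [|g r IHr] c x c' y nz_c nz_c' pr nmcd irr.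
  rewrite big_nil => f1; apply: (@no_mcd_nonunit c x c' y nmcd).
  by rewrite f1; exists 1; rewrite mulr1.
rewrite big_cons => def_f; have ne_xy := primitive_pair_neq pr.
have [[a [m def_g]] | [a [m def_h]]] := two_terms_factor pr nz_c def_f.
  rewrite def_g in def_f.
  have [b [x' [b' [y' [nz_b nz_b' def_x def_y def_h]]]]] :=
    two_terms_div_monomial Mcanc nz_c nz_c' ne_xy def_f.
  rewrite def_x def_y in pr nmcd.
  apply: (IHr b x' b' y') => //; first exact: primitive_pair_div pr.
    exact: no_mcd_div nmcd.
  by move=> k kr; apply: irr; rewrite inE kr orbT.
(* Here the other factors multiply to a monomial, so [g] is the binomial; a nontrivial common
   divisor [z] of its exponents splits off [<<z>>], against irreducibility. *)
rewrite def_h mulrC in def_f.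
have [b [x' [b' [y' [nz_b nz_b' def_x def_y def_g]]]]] :=
  two_terms_div_monomial Mcanc nz_c nz_c' ne_xy def_f.
rewrite def_x def_y in nmcd.
have [z [x'' [y'' [ne_z def_x' def_y']]]] := nmcd _ _ _ erefl erefl.
have [_ _ /(_ <<z>> (two_terms b x'' b' y''))] := irr g (mem_head _ _).
case.
- rewrite def_g def_x' def_y' /two_terms mulrDr !malgM_def !fgmulUU.
  by rewrite !mul1r.
- by move/mcoeff1_runit; rewrite mcoeffU1 (negbTE ne_z) eqxx.
- apply: no_mcd_nonunit; move/no_mcd_div: nmcd.
  by rewrite def_x' def_y' => /no_mcd_div.
Qed.

Lemma no_mcd_not_ratomic (Mcanc : mcancellative M) x y :
  primitive_pair x y -> no_mcd x y -> ~ ratomic {malg R[M]}.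
Proof.
move=> pr nmcd /(_ (two_terms 1 x 1 y)).
case=> [||r [irr]].
- by rewrite two_terms_neq0 ?oner_eq0 ?primitive_pair_neq.
- exact: no_mcd_nonunit.
by apply: two_terms_not_prod; rewrite ?oner_eq0.
Qed.

End MonoidAlgebra.

(** * The monoid *)

Implicit Types (x y c : {poly int}) (k n : nat) (b j : bool) (i : bool * nat).

(* G is {poly int}: t_j is ['X^j] for j = 0, 1, d_n is ['X^(3 * n + 2)] and
   p_{j,n} is ['X^(3 * n + 3 + j)].  [tail j n] is d_0 + ... + d_n + p_{j,n},
   and [qgen (j, n)] is q_{j,n}. *)
Definition tail_mem (j : bool) (n k : nat) : bool :=
  ((k %% 3 == 2) && (k <= 3 * n + 2) || (k == 3 * n + 3 + j))%N.

Definition tail (j : bool) (n : nat) : {poly int} :=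
  \poly_(k < 3 * n + 5) (tail_mem j n k)%:R.

Definition qgen (i : bool * nat) : {poly int} := 'X^(i.1) - tail i.1 i.2.

Lemma coef_tail j n k : (tail j n)`_k = (tail_mem j n k)%:R.
Proof.
rewrite coef_poly; case: ifP => // /negbT le_nk.
suff -> : tail_mem j n k = false by [].
by apply/negbTE; move: le_nk; rewrite /tail_mem; case: j => /=; lia.
Qed.

Lemma coef_qgen i k :
  (qgen i)`_k = (k == i.1 :> nat)%:R - (tail_mem i.1 i.2 k)%:R.
Proof. by rewrite coefB coefXn coef_tail. Qed.

Lemma coef_qgen_lt2 i k : (k < 2)%N -> (qgen i)`_k = (k == i.1 :> nat)%:R.
Proof.
move=> lt_k2; rewrite coef_qgen.
suff -> : tail_mem i.1 i.2 k = false by rewrite subr0.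
by case: k lt_k2 => [|[|]] //; rewrite /tail_mem; case: i.1 => /=; lia.
Qed.

(** * The cone of M and its two level functions *)

(** The list [l] records the q-generators; [c] is a combination of the d_n and p_{j,n}, whose
    indices exhaust all k >= 2. *)
Definition cone (x : {poly int}) : Prop :=
  exists l c, [/\ x = \sum_(i <- l) qgen i + c,
                  forall k, (k < 2)%N -> c`_k = 0 & forall k, 0 <= c`_k].

(* [simpl] identifies the syntactically different forms of [int] under which
   coefficients occur; [lia] would treat them as different atoms. *)
Local Ltac coef_lia := simpl in *; lia.

Lemma cone0 : cone 0.
Proof. by exists [::], 0; split=> [|k|k]; rewrite ?big_nil ?addr0 ?coef0. Qed.

Lemma coneD x y : cone x -> cone y -> cone (x + y).
Proof.
case=> l [c [-> c0 c_ge0]] [l' [c' [-> c0' c_ge0']]].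
exists (l ++ l'), (c + c'); split=> [|k k2|k]; first by rewrite big_cat addrACA.
  by rewrite coefD c0 ?c0'.
by rewrite coefD addr_ge0.
Qed.

Lemma cone_nonneg x :
  (forall k, (k < 2)%N -> x`_k = 0) -> (forall k, 0 <= x`_k) -> cone x.
Proof. by move=> x0 x_ge0; exists [::], x; rewrite big_nil add0r. Qed.

Lemma cone_qgen i : cone (qgen i).
Proof.
by exists [:: i], 0; split=> [|k|k]; rewrite ?coef0 // big_seq1 addr0.
Qed.

Lemma coneXn k : cone 'X^k.
Proof.
have cone_ge2 n : (2 <= n)%N -> cone 'X^n.
  move=> le2n; apply: cone_nonneg => i; rewrite coefXn // => lt_i2.
  by case: eqP => // eq_in; lia.
case: (leqP 2 k) => [|lt_k2]; first exact: cone_ge2.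
have [j ->] : exists j : bool, k = j.
  by case: k lt_k2 => [|[|]] //; [exists false | exists true].
(* This is t_j = q_{j,0} + (d_0 + p_{j,0}). *)
rewrite -[X in cone X](subrK (tail j 0)); apply: coneD.
  exact: (cone_qgen (j, 0%N)).
apply: cone_nonneg => i; rewrite coef_tail // => lt_i2.
by case: i lt_i2 => [|[|]] //; rewrite /tail_mem; case: j.
Qed.

Lemma poly_nonneg_ind (P : {poly int} -> Prop) x :
    P 0 -> (forall y z, P y -> P z -> P (y + z)) ->
    (forall k, x`_k != 0 -> P 'X^k) -> (forall k, 0 <= x`_k) -> P x.
Proof.
move=> P0 PD PX x_ge0; rewrite -[x]coefK poly_def; apply: big_ind => // i _.
have [-> | nz_xi] := eqVneq x`_i 0; first by rewrite scale0r.
have [m ->] : exists m : nat, x`_i = m%:R.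
  by case: (x`_i) (x_ge0 i) => // m _; exists m; rewrite natz.
rewrite scaler_nat; elim: m => [|m IHm]; first by rewrite mulr0n.
by rewrite mulrS; apply: PD => //; apply: PX.
Qed.

Lemma cone_ind (P : {poly int} -> Prop) :
    P 0 -> (forall y z, P y -> P z -> P (y + z)) ->
    (forall k, (2 <= k)%N -> P 'X^k) -> (forall i, P (qgen i)) ->
  forall x, cone x -> P x.
Proof.
move=> P0 PD PX Pq x [l [c [-> c0 c_ge0]]]; apply: (PD).
  by elim: l => [|i l IHl]; rewrite (big_nil, big_cons) //; apply: PD.
apply: poly_nonneg_ind => // k.
by case: (leqP 2 k) => [/PX // | /c0 ->]; rewrite eqxx.
Qed.

Lemma cone_nonneg_coef x : (forall k, 0 <= x`_k) -> cone x.
Proof.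
move=> x_ge0; apply: poly_nonneg_ind => //; first exact: cone0.
  exact: coneD.
by move=> k _; apply: coneXn.
Qed.

(** Among the generators only the q_{b,n} involve t_b, so the coefficient at [b] is an additive
    level counting them. *)
Lemma coef_cone_lt2 l c (b : bool) : (forall k, (k < 2)%N -> c`_k = 0) ->
  (\sum_(i <- l) qgen i + c)`_b = (count (fun i => i.1 == b) l)%:R.
Proof.
move=> c0; have b2 : (b < 2)%N by case: b.
rewrite coefD c0 // addr0 coef_sum.
elim: l => [|i l IHl]; first by rewrite big_nil.
rewrite big_cons /= natrD IHl coef_qgen_lt2 //.
by case: i.1; case: (b).
Qed.

Lemma cone_coef_ge0 x (b : bool) : cone x -> 0 <= x`_b.
Proof. by case=> l [c [-> c0 _]]; rewrite coef_cone_lt2. Qed.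

Lemma cone_level0 x : cone x -> x`_0 = 0 -> x`_1 = 0 -> forall k, 0 <= x`_k.
Proof.
case=> l [c [-> c0 c_ge0]].
rewrite (coef_cone_lt2 l false c0) (coef_cone_lt2 l true c0).
case: l => [_ _ k|[[] n] l]; rewrite ?big_nil ?add0r //=; lia.
Qed.

(** The levels force exactly one q-generator, of type [b]; the remainder [c] is nonnegative. *)
Lemma cone_level1 x (b : bool) : cone x -> x`_b = 1 -> x`_(~~ b) = 0 ->
  exists n, forall k, (qgen (b, n))`_k <= x`_k.
Proof.
case=> l [c [-> c0 c_ge0]]; rewrite !coef_cone_lt2 //.
case: l => [|[b' n] [|[b'' n'] l]] //=;
  last by case: b; case: b'; case: b'' => /=; lia.
case: (b' =P b) => [-> _ _ | ne_b]; last by case: b b' ne_b => [] [].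
by exists n => k; rewrite big_seq1 [leRHS]coefD lerDl.
Qed.

(** * Decompositions of the generators inside the cone *)

Lemma nonneg_add_eq0 (x y : {poly int}) :
  x + y = 0 -> (forall k, 0 <= x`_k) -> (forall k, 0 <= y`_k) -> x = 0 /\ y = 0.
Proof.
move=> /polyP xy0 x_ge0 y_ge0.
by split; apply/polyP => k; have := xy0 k; have := x_ge0 k; have := y_ge0 k;
  rewrite coefD coef0; lia.
Qed.

Lemma cone_add_coef_lt2 x y (b : bool) : cone x -> cone y -> (x + y)`_b = 0 ->
  x`_b = 0 /\ y`_b = 0.
Proof.
move=> /(cone_coef_ge0 b) x_ge0 /(cone_coef_ge0 b) y_ge0.
by rewrite coefD => ?; split; lia.
Qed.

Lemma cone_add_level0 x y : cone x -> cone y ->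
  (x + y)`_0 = 0 -> (x + y)`_1 = 0 ->
  (forall k, 0 <= x`_k) /\ (forall k, 0 <= y`_k).
Proof.
move=> cx cy /(@cone_add_coef_lt2 _ _ false)[] // x0 y0.
move=> /(@cone_add_coef_lt2 _ _ true)[] // x1 y1.
by split; apply: cone_level0.
Qed.

Lemma cone_add_eq0 x y : cone x -> cone y -> x + y = 0 -> x = 0 /\ y = 0.
Proof.
move=> cx cy xy0.
by have [||x_ge0 y_ge0] := cone_add_level0 cx cy; rewrite ?xy0 ?coef0 //;
  apply: nonneg_add_eq0.
Qed.

Lemma cone_addXn k x y : (2 <= k)%N -> cone x -> cone y -> 'X^k = x + y ->
  x = 0 \/ y = 0.
Proof.
move=> le2k cx cy def_k.
have [||x_ge0 y_ge0] := cone_add_level0 cx cy;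
  rewrite -?def_k ?coefXn; try coef_lia.
have eq_k (l : nat) : x`_l + y`_l = (l == k)%:R by rewrite -coefXn def_k coefD.
have [xk0 | yk0] : x`_k = 0 \/ y`_k = 0.
- by have := eq_k k; have := x_ge0 k; have := y_ge0 k; rewrite eqxx; coef_lia.
- left; apply/polyP => l; rewrite coef0.
  have := eq_k l; have := x_ge0 l; have := y_ge0 l.
  by case: (l =P k) => [-> | _]; coef_lia.
- right; apply/polyP => l; rewrite coef0.
  have := eq_k l; have := x_ge0 l; have := y_ge0 l.
  by case: (l =P k) => [-> | _]; coef_lia.
Qed.

Lemma cone_add_qgen_aux b n x y : cone x -> cone y -> qgen (b, n) = x + y ->
  x`_b = 1 -> y = 0.
Proof.
move=> cx cy def_q xb1.
have eq_q k : x`_k + y`_k = (qgen (b, n))`_k by rewrite def_q coefD.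
have nb2 : (~~ b < 2)%N by case: (b).
have [] := @cone_add_coef_lt2 x y (~~ b) cx cy.
  by rewrite -def_q coef_qgen_lt2 //; case: (b).
move=> xnb ynb; have yb : y`_b = 0.
  have := eq_q b; rewrite xb1 coef_qgen_lt2 ?eqxx; last by case: (b).
  by move=> ?; coef_lia.
have y_ge0 : forall k, 0 <= y`_k.
  by apply: cone_level0 => //; case: (b) yb ynb.
have [m le_m] := cone_level1 cx xb1 xnb.
(* The index [3 * n + 3 + b] is that of p_{b,n}, where q_{b,n} is -1. As [y] is nonnegative, q_{b,m}
   must be negative there too, and p_{b,n} occurs in no other q_{b,m}. *)
have eq_mn : m = n.
  have := eq_q (3 * n + 3 + b)%N; have := le_m (3 * n + 3 + b)%N.
  have := y_ge0 (3 * n + 3 + b)%N.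
  rewrite !coef_qgen /= /tail_mem.
  by case: (b); coef_lia.
subst m; apply/polyP => k; rewrite coef0.
by have := eq_q k; have := le_m k; have := y_ge0 k; coef_lia.
Qed.

Lemma cone_add_qgen i x y : cone x -> cone y -> qgen i = x + y ->
  x = 0 \/ y = 0.
Proof.
case: i => b n cx cy def_q.
have x_ge0 := cone_coef_ge0 b cx; have y_ge0 := cone_coef_ge0 b cy.
have : x`_b + y`_b = 1.
  by rewrite -coefD -def_q coef_qgen_lt2 ?eqxx //; case: (b).
have [xb1 | ne_xb1] := x`_b =P 1 :> int => sum1.
  by right; apply: cone_add_qgen_aux def_q xb1.
left; apply: (@cone_add_qgen_aux b n y x) => //; first by rewrite addrC.
coef_lia.
Qed.

(** * The monoid structure, torsion-freeness and atomicity *)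

(** A classical Boolean version of [cone], which lets [cone_monoid] be a subtype of [{poly int}] and
    inherit its choice structure. *)
Definition in_cone : pred {poly int} :=
  fun x => if excluded_middle_informative (cone x) then true else false.

Lemma in_coneP x : reflect (cone x) (in_cone x).
Proof. by rewrite /in_cone; case: excluded_middle_informative; constructor. Qed.

Record cone_monoid := ConeElement { mval :> {poly int}; mvalP : in_cone mval }.

HB.instance Definition _ := [isSub for mval].
HB.instance Definition _ := [Choice of cone_monoid by <:].

Definition cone_elt x (cx : cone x) : cone_monoid :=
  ConeElement (introT (in_coneP x) cx).

Lemma mval_cone (u : cone_monoid) : cone u.
Proof. exact/in_coneP/mvalP. Qed.

Definition cone_one := cone_elt cone0.
Definition cone_mul (u v : cone_monoid) :=
  cone_elt (coneD (mval_cone u) (mval_cone v)).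

Fact cone_mulA : associative cone_mul.
Proof. by move=> x y z; apply/val_inj/addrA. Qed.
Fact cone_mulC : commutative cone_mul.
Proof. by move=> x y; apply/val_inj/addrC. Qed.
Fact cone_mul1 : left_id cone_one cone_mul.
Proof. by move=> x; apply/val_inj/add0r. Qed.
Fact cone_mulr1 : right_id cone_one cone_mul.
Proof. by move=> x; apply/val_inj/addr0. Qed.
(** This is reducedness, built into [conomType]: both summands have level 0, hence nonnegative
    coefficients, and their sum is 0. *)
Fact cone_mul_eq1 u v :
  cone_mul u v = cone_one -> u = cone_one /\ v = cone_one.
Proof.
move=> /(congr1 val) /= /(cone_add_eq0 (mval_cone u) (mval_cone v))[x0 y0].
by split; apply: val_inj.
Qed.

HB.instance Definition _ := Choice_isMonomialDef.Build cone_monoid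
  cone_mulA cone_mul1 cone_mulr1 cone_mul_eq1.
HB.instance Definition _ := MonomialDef_isConomialDef.Build cone_monoid
  cone_mulC.

Lemma mvalM (x y : cone_monoid) : mval (mmul x y) = mval x + mval y.
Proof. by []. Qed.

Lemma cone_monoid_cancellative : mcancellative cone_monoid.
Proof. by move=> u v w /(congr1 mval); rewrite !mvalM => /addrI/val_inj. Qed.

Lemma munit_mone (M : conomType) (u : M) : munit u <-> u = mone.
Proof.
by split=> [[v /unitm[]] // | ->]; exists mone; rewrite mul1m.
Qed.

Lemma mval_mpow (u : cone_monoid) n : mval (mpow u n) = mval u *+ n.
Proof. by elim: n => [|n IHn] //; rewrite mulrS -IHn. Qed.

Lemma cone_monoid_torsion_free : mtorsion_free cone_monoid.
Proof.
move=> n u v n_gt0 /(congr1 mval); rewrite !mval_mpow => eq_uv.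
apply: val_inj; apply/polyP => k; move/polyP/(_ k)/eqP: eq_uv.
by rewrite !coefMn eqr_pMn2r // => /eqP.
Qed.

Lemma matom_mk x (cx : cone x) : x != 0 ->
    (forall y z, cone y -> cone z -> x = y + z -> y = 0 \/ z = 0) ->
  matom (cone_elt cx).
Proof.
move=> nz_x atom_x; split=> [/munit_mone/(congr1 mval) /= x0 | u v].
  by rewrite x0 eqxx in nz_x.
move/(congr1 mval); rewrite mvalM /=.
case/atom_x; rewrite ?munit_mone; try exact: mval_cone.
  by left; apply: val_inj.
by right; apply: val_inj.
Qed.

Lemma cone_monoid_atomic : matomic cone_monoid.
Proof.
pose sum_atoms x := exists s : seq cone_monoid,
  (forall a, a \in s -> matom a) /\ x = mval (foldr mmul mone s).
have atom_sum x (cx : cone x) : matom (cone_elt cx) -> sum_atoms x.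
  move=> atom_x; exists [:: cone_elt cx].
  split=> [a | /=]; first by rewrite inE => /eqP->.
  by rewrite addr0.
suff all_sum x : cone x -> sum_atoms x.
  move=> u _; have [s [atoms def_u]] := all_sum _ (mval_cone u).
  by exists s; split=> //; apply: val_inj.
move: x; apply: cone_ind => [|x y [s [s_at ->]] [t [t_at ->]]|k le2k|i].
- by exists [::]; split.
- exists (s ++ t); split=> [a|]; first by rewrite mem_cat => /orP[/s_at|/t_at].
  rewrite foldr_cat -mvalM; congr mval.
  by elim: (s) => [|a r IHr] /=; rewrite ?mul1m // -mulmA IHr.
- apply: (atom_sum _ (coneXn k)); apply: matom_mk => [|y z cy cz].
    by rewrite monic_neq0 ?monicXn.
  exact: cone_addXn.
apply: (atom_sum _ (cone_qgen i)); apply: matom_mk => [|y z cy cz].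
  apply/eqP => /polyP/(_ i.1); rewrite coef_qgen_lt2 ?eqxx ?coef0 //.
  by case: i.1.
exact: cone_add_qgen.
Qed.

(** * The Grothendieck group and the rank *)

Lemma sum_Xn_coef (c : nat -> int) n :
  \sum_(l < n) 'X^l *~ c l = \poly_(l < n) c l.
Proof.
by rewrite poly_def; apply: eq_bigr => l _; rewrite -scaler_int intz.
Qed.

Lemma rank_aleph0_poly : rank_aleph0 {poly int}.
Proof.
exists (fun n => 'X^n); split=> [n c | x].
  rewrite sum_Xn_coef => /polyP c0 k lt_kn.
  by have := c0 k; rewrite coef_poly lt_kn coef0.
exists 1, (size x), (nth 0 x); split=> //.
by rewrite sum_Xn_coef coefK mulr1z.
Qed.

Lemma cone_monoid_rank : mrank_aleph0 cone_monoid.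
Proof.
exists {poly int}, mval; split; last exact: rank_aleph0_poly.
split=> // [|x]; first exact: val_inj.
(* Each polynomial is the difference of its positive and negative parts, which lie in the cone
   because every power of ['X] does. *)
pose pos y : {poly int} := \poly_(l < size y) Num.max y`_l 0.
have cone_pos y : cone (pos y).
  apply: cone_nonneg_coef => k; rewrite coef_poly.
  by case: ifP => // _; rewrite le_max lexx orbT.
exists (cone_elt (cone_pos x)), (cone_elt (cone_pos (- x))) => /=.
apply/polyP => k; rewrite coefB !coef_poly size_polyN coefN.
case: (ltnP k (size x)) => [_ | /(nth_default 0) -> //].
have max_sub (a : int) : a = Num.max a 0 - Num.max (- a) 0 by lia.
exact: max_sub.
Qed.

(** * Primitivity of the pair t_0, t_1 *)

Lemma nonroot_exists (p : {poly int}) : p != 0 -> exists N : int, p.[N] != 0.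
Proof.
move=> nz_p; pose rs := [seq l%:R : int | l <- iota 0 (size p)].
have uniq_rs : uniq rs.
  by rewrite map_inj_uniq ?iota_uniq // => l l' /eqP; rewrite eqr_nat => /eqP.
case: (boolP (all (root p) rs)) => [all_rs | /allPn[N _ nroot]].
  have := max_poly_roots nz_p all_rs uniq_rs.
  by rewrite size_map size_iota ltnn.
by exists N.
Qed.

(* The automorphism of the free abelian group on the ['X^k] fixing ['X^k] for
   [k != 0] and sending [1] to ['X - 1]; after it, any evaluation takes values
   differing by [1] at ['X] and [1]. *)
Definition shear x : {poly int} := x + x`_0 *: ('X - 2%:P).

Lemma shearD : {morph shear : x y / x + y}.
Proof. by move=> x y; rewrite /shear coefD scalerDl addrACA. Qed.

Lemma shear_eq0 x : shear x = 0 -> x = 0.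
Proof.
(* The constant coefficient of [shear x] is minus that of [x]. *)
rewrite /shear => eq0; have x0 : x`_0 = 0.
  move/polyP/(_ 0%N): eq0.
  by rewrite coefD coefZ coefB coefX coefC coef0 /=; lia.
by move: eq0; rewrite x0 scale0r addr0.
Qed.

Definition vertex (b : bool) : cone_monoid := cone_elt (coneXn b).

(** The functional is [shear] followed by evaluation at [N]. It separates the elements of [s] once
    [N] is not a root of any sheared difference of two distinct ones; [P] is the product of these
    differences. *)
Lemma vertex_primitive : primitive_pair (vertex false) (vertex true).
Proof.
move=> s; pose diff (uv : cone_monoid * cone_monoid) :=
  if uv.1 == uv.2 then 1 else shear (mval uv.1 - mval uv.2).
pose P := \prod_(uv <- [seq (u, v) | u <- s, v <- s]) diff uv.
have [|N nroot] := @nonroot_exists P.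
  rewrite prodf_seq_neq0; apply/allP => -[u v] _; rewrite /diff /=.
  case: (u =P v) => [_ | ne_uv]; first by rewrite oner_eq0.
  apply/eqP => /shear_eq0/eqP; rewrite subr_eq0 => /eqP/val_inj; exact: ne_uv.
exists (fun u => (shear (mval u)).[N]); split=> [u v | u v us vs eq_uv |].
- by rewrite mvalM shearD hornerD.
- apply/eqP; apply: contraR nroot => ne_uv.
  rewrite /P horner_prod (big_rem (u, v)) /=; last first.
    by apply/allpairsP; exists (u, v).
  have := shearD (mval u - mval v) (mval v); rewrite subrK => shear_u.
  move: eq_uv; rewrite shear_u hornerD => /(canRL (addrK _)).
  by rewrite subrr /diff /= (negbTE ne_uv) => ->; rewrite mul0r.
- rewrite /shear !coefXn scale1r scale0r addr0 !hornerD hornerN !hornerXn.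
  by rewrite hornerC /=; ring.
Qed.

(** * Common divisors of t_0 and t_1 *)

(** The p-indices are 0 mod 3 for [false] and 1 mod 3 for [true], so the two tails share only d_i
    with i <= n. *)
Lemma tail_mem_inter b n m k :
  tail_mem false n k -> tail_mem true m k -> tail_mem b n.+1 k.
Proof. by rewrite /tail_mem /=; case: b; lia. Qed.

Lemma vertex_no_mcd : no_mcd (vertex false) (vertex true).
Proof.
move=> d u v /(congr1 mval); rewrite mvalM /= => def_x.
move=> /(congr1 mval); rewrite mvalM /= => def_y.
have [d1 u1] : (mval d)`_1 = 0 /\ (mval u)`_1 = 0.
  apply: (@cone_add_coef_lt2 _ _ true); try exact: mval_cone.
  by rewrite -def_x coefXn.
have [d0 v0] : (mval d)`_0 = 0 /\ (mval v)`_0 = 0.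
  apply: (@cone_add_coef_lt2 _ _ false); try exact: mval_cone.
  by rewrite -def_y coefXn.
have d_ge0 : forall k, 0 <= (mval d)`_k.
  by apply: cone_level0 => //; apply: mval_cone.
have ux k : (mval d)`_k + (mval u)`_k = (k == 0)%:R.
  by rewrite -coefD -def_x coefXn.
have vy k : (mval d)`_k + (mval v)`_k = (k == 1%N)%:R.
  by rewrite -coefD -def_y coefXn.
(* The divisor [d] has level 0, so each cofactor contains one q-generator; this bounds [d] by
   [tail false n] and by [tail true m]. *)
have [n le_n] : exists n, forall k, (qgen (false, n))`_k <= (mval u)`_k.
  by apply: cone_level1 => //; [apply: mval_cone | have := ux 0%N; coef_lia].
have [m le_m] : exists n, forall k, (qgen (true, n))`_k <= (mval v)`_k.
  by apply: cone_level1 => //; [apply: mval_cone | have := vy 1%N; coef_lia].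
(* The enlarging element is d_{n+1}: it is absent from [tail false n], hence from [d], and present
   in both tails of index [n.+1]. *)
pose z : {poly int} := 'X^(3 * n.+1 + 2).
have le_tail (b : bool) k : (mval d)`_k + z`_k <= (tail b n.+1)`_k.
  have le_n' : (mval d)`_k <= (tail_mem false n k)%:R.
    have := le_n k; have := ux k; rewrite coef_qgen /= => <-; coef_lia.
  have le_m' : (mval d)`_k <= (tail_mem true m k)%:R.
    have := le_m k; have := vy k; rewrite coef_qgen /= => <-; coef_lia.
  rewrite coef_tail coefXn; have [eq_k | ne_k] := k =P _.
    move: le_n'; have -> : tail_mem false n k = false.
      by rewrite /tail_mem /=; lia.
    have -> : tail_mem b n.+1 k by rewrite /tail_mem eq_k; lia.
    coef_lia.
  move: le_n' le_m'; have := @tail_mem_inter b n m k.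
  case: (tail_mem false n k); case: (tail_mem true m k) => inter le_n' le_m';
    first by rewrite inter //; coef_lia.
  1-3: by case: (tail_mem b _ _); coef_lia.
(* The new cofactor is q_{b,n+1} plus the nonnegative difference [tail b n.+1 - mval d - z]. *)
have cone_rest (b : bool) : cone ('X^b - mval d - z).
  rewrite -['X^b](subrK (tail b n.+1)) -2!addrA; apply: coneD.
    exact: (cone_qgen (b, n.+1)).
  apply: cone_nonneg_coef => k; rewrite coefD coefB !coefN.
  by rewrite -opprD subr_ge0.
exists (cone_elt (coneXn (3 * n.+1 + 2))).
exists (cone_elt (cone_rest false)), (cone_elt (cone_rest true)); split.
- apply/eqP => /(congr1 mval)/eqP; apply/negP.
  by rewrite monic_neq0 ?monicXn.
- by apply: val_inj; rewrite /= addrC subrK def_x addrC addKr.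
- by apply: val_inj; rewrite /= addrC subrK def_y addrC addKr.
Qed.

Theorem theorem3p2 :
  exists M : conomType,
    [/\ mcancellative M, mreduced M, mtorsion_free M, matomic M &
        mrank_aleph0 M /\
        forall R : idomainType, ~ ratomic {malg R[M]}].
Proof.
exists cone_monoid; split.
- exact: cone_monoid_cancellative.
- by move=> u /munit_mone.
- exact: cone_monoid_torsion_free.
- exact: cone_monoid_atomic.
split; first exact: cone_monoid_rank.
move=> R; apply: no_mcd_not_ratomic vertex_primitive vertex_no_mcd.
exact: cone_monoid_cancellative.
Qed.
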